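(* Consider online label shift adaptation with the re-weighting hypothesis class and the Online Gradient Descent (OGD) algorithm as described in the context, run for $T\ge 1$ steps. Suppose that $C_{f_0,Q_0}$ is invertible and that: (1) (Differentiability) $\mathsf{diag}\left(C_{g(\cdot;f_0,\mathbf{q}_0,\mathbf{p}),Q_0}\right)$ is differentiable with respect to $\mathbf{p}$; (2) (Convexity) for every $\mathbf{q}\in\Delta^{M-1}$, $\ell(\mathbf{p};\mathbf{q})$ is convex in $\mathbf{p}\in\Delta^{M-1}$; (3) (Lipschitzness) $L:=\sup_{\mathbf{p}\in\Delta^{M-1},\,i=1,\dots,M}\left\lVert\nabla_{\mathbf{p}}\ell\left(\mathbf{p};\left(C_{f_0,Q_0}^\top\right)^{-1}\mathbf{e}_i\right)\right\rVert_2$ is finite. If the learning rate is $\eta=\sqrt{\frac{2}{T}}\frac{1}{L}$, then the OGD iterates $\mathbf{p}_1,\dots,\mathbf{p}_T$ satisfy $$\mathbb{E}_{(\mathbf{x}_t,y_t)\sim Q_t}\left[\frac1T\sum_{t=1}^T\ell(\mathbf{p}_t;\mathbf{q}_t)\right]-\inf_{\mathbf{p}\in\Delta^{M-1}}\frac1T\sum_{t=1}^T\ell(\mathbf{p};\mathbf{q}_t)\le\sqrt{\frac2T}\,L .$$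
   Context: Basic setting. $\mathcal{X}$ is a feature space, $\mathcal{Y}=\{1,\dots,M\}$, $\Delta^{M-1}$ is the probability simplex in $\mathbb{R}^M$, and $\mathbf{e}_i$ is the $i$-th standard basis vector. $Q_0$ is a fixed training distribution on $\mathcal{X}\times\mathcal{Y}$ with class-conditionals $Q_0(\mathbf{x}\mid y)$ and label marginal vector $\mathbf{q}_0\in\Delta^{M-1}$, whose entries are positive. For $t=1,\dots,T$, $Q_t$ is a fixed distribution with the same class-conditionals, $Q_t(\mathbf{x}\mid y)=Q_0(\mathbf{x}\mid y)$, and label marginal vector $\mathbf{q}_t\in\Delta^{M-1}$, $\mathbf{q}_t[i]=\mathbb{P}_{Q_t}(y_t=i)$. The samples $(\mathbf{x}_t,y_t)\sim Q_t$, $t=1,\dots,T$, are independent; the learner sees only $\mathbf{x}_t$. Classifiers. For a classifier $f:\mathcal{X}\to\mathcal{Y}$ the confusion matrix is $C_{f,Q_0}[i,j]=\mathbb{P}_{\mathbf{x}\sim Q_0(\cdot\mid y=i)}(f(\mathbf{x})=j)$, and $\mathsf{diag}(\cdot)$ denotes the vector of diagonal entries. The base classifier $f_0$ outputs a probability vector $P_{f_0}(\mathbf{x})\in\Delta^{M-1}$ and predicts $f_0(\mathbf{x})=\arg\max_y P_{f_0}(\mathbf{x})[y]$. For a re-weighting vector $\mathbf{p}$, the re-weighted classifier is $$g(\mathbf{x};f_0,\mathbf{q}_0,\mathbf{p})=\arg\max_{y\in\mathcal{Y}}\frac{\mathbf{p}[y]}{\mathbf{q}_0[y]}P_{f_0}(\mathbf{x})[y]$$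 (ties broken by a fixed rule; the paper's positive normalization factor, which does not affect the argmax, is omitted). Loss. For $\mathbf{q}\in\mathbb{R}^M$, $\ell(\mathbf{p};\mathbf{q})=\left\langle\mathbf{1}-\mathsf{diag}\left(C_{g(\cdot;f_0,\mathbf{q}_0,\mathbf{p}),Q_0}\right),\mathbf{q}\right\rangle$, which is linear in $\mathbf{q}$. For $\mathbf{q}=\mathbf{q}_t$ it equals the expected 0-1 loss $\mathbb{P}_{(\mathbf{x},y)\sim Q_t}(g(\mathbf{x};f_0,\mathbf{q}_0,\mathbf{p})\ne y)$. Derivatives in $\mathbf{p}$ are taken in $\mathbb{R}^M$ at points of $\Delta^{M-1}$. Estimator. $\hat{\mathbf{q}}_t=\left(C_{f_0,Q_0}^\top\right)^{-1}\mathbf{e}_{f_0(\mathbf{x}_t)}$. OGD. $\mathbf{p}_1=\mathbf{q}_0$ (so that the first classifier is $f_0$), and for $t\ge1$ $$\mathbf{p}_{t+1}=\mathsf{Proj}_{\Delta^{M-1}}\left(\mathbf{p}_t-\eta\,\nabla_{\mathbf{p}}\ell(\mathbf{p};\hat{\mathbf{q}}_t)\big|_{\mathbf{p}=\mathbf{p}_t}\right),$$ where $\mathsf{Proj}_{\Delta^{M-1}}$ is Euclidean projection onto $\Delta^{M-1}$ and $\eta>0$ is the learning rate. Exact values and gradients of $C_{\cdot,Q_0}$ are assumed available. The expectation in the claim is over all samples. *)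

(* Defs.v *)
From HB Require Import structures.
From mathcomp Require Import all_boot all_order all_algebra.
From mathcomp Require Import all_classical all_reals all_analysis.

Set Implicit Arguments.
Unset Strict Implicit.
Unset Printing Implicit Defensive.

Import Order.TTheory GRing.Theory Num.Theory.
Import numFieldNormedType.Exports.

Local Open Scope classical_set_scope.
Local Open Scope ring_scope.

HB.instance Definition _ (n : nat) := isPointed.Build 'I_n.+1 ord0.

HB.instance Definition _ (n : nat) :=
  @isMeasurable.Build default_measure_display 'I_n.+1
    discrete_measurable discrete_measurable0
    discrete_measurableC discrete_measurableU.

Section Euclidean.
Context {R : realType} {M : nat}.
Implicit Types (p u v : 'rV[R]_M).

Definition dotv u v : R := \sum_i u 0 i * v 0 i.

(* The library norm on ['rV[R]_M] is the sup norm, hence a separate one. *)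
Definition norm2 v : R := Num.sqrt (dotv v v).

Definition simplex : set 'rV[R]_M :=
  [set p | (forall i, 0 <= p 0 i) /\ \sum_i p 0 i = 1].

Definition simplex_proj v : 'rV[R]_M :=
  get [set p | simplex p /\
    forall p', simplex p' -> norm2 (v - p) <= norm2 (v - p')].

Definition orthant : set 'rV[R]_M := [set p | forall i, 0 <= p 0 i].

(* Re-weighting vectors are nonnegative, so the increments used for a
   derivative at a boundary point of the simplex are those that stay in the
   orthant; all increments of R^M occur at an interior point. The orthant has
   nonempty interior, so the M partial derivatives are determined everywhere on
   it, and they are the usual ones as soon as the function is differentiable on
   a full neighbourhood ([diff_orthant], [grad_ambient]). *)
Definition wnbhs p := within orthant (nbhs p).

Definition grad (f : 'rV[R]_M -> R) p : 'rV[R]_M :=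
  \row_i 'd (f : 'rV[R]_M -> R^o) (wnbhs p) (delta_mx 0 i).

Lemma wnbhs_lim p : orthant p -> lim (wnbhs p) = p.
Proof.
move=> p0; have PF : ProperFilter (wnbhs p).
  by apply: within_nbhs_proper; exact: subset_closure.
by apply: (@cvg_lim _ _ _ (wnbhs p) PF id p) => //; exact: cvg_within.
Qed.

Lemma norm_delta_le1 (i : 'I_M) : `|delta_mx 0 i : 'rV[R]_M| <= 1.
Proof.
rewrite -[leLHS]/(mx_norm _).
have [->|/mx_norm_neq0[j ->]] := eqVneq (mx_norm (delta_mx 0 i : 'rV[R]_M)) 0.
  by [].
by rewrite mxE ger0_norm ?ler0n// lern1 leq_b1.
Qed.

Lemma orthant_linear_eq (W : normedModType R) (l1 l2 : {linear 'rV[R]_M -> W}) p :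
  orthant p ->
  (forall e, 0 < e -> \forall x \near wnbhs p,
    `|l1 (x - p) - l2 (x - p)| <= e * `|x - p|) ->
  l1 = l2 :> ('rV[R]_M -> W).
Proof.
move=> p0 small; suff de i : l1 (delta_mx 0 i) = l2 (delta_mx 0 i).
  apply/funext => v; rewrite (row_sum_delta v) 2!linear_sum.
  by apply: eq_bigr => i _; rewrite 2!linearZ; congr (_ *: _).
apply/eqP; rewrite -subr_eq0 -normr_le0; apply/ler_addgt0Pl => e e0.
have := small e e0; rewrite /wnbhs /within/= => /nbhs_ballP[r /= r0 rP].
set v : 'rV[R]_M := delta_mx 0 i.
have [t t0 tr] : exists2 t, 0 < t & t < r.
  by exists (r / 2); rewrite ?divr_gt0// ltr_pdivrMr// ltr_pMr// ltr1n.
have /rP : ball p r (p + t *: v).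
  rewrite -ball_normE/= opprD addNKr normrN normrZ gtr0_norm//.
  by rewrite (le_lt_trans _ tr)// ler_piMr ?norm_delta_le1// ltW.
rewrite addrAC subrr add0r 2!linearZ -scalerBr 2!normrZ (gtr0_norm t0) mulrCA.
rewrite ler_pM2l// => H.
rewrite addr0; apply: le_trans (H _) _.
  by move=> j; rewrite !mxE addr_ge0 ?p0// mulr_ge0 ?ler0n// ltW.
by rewrite ler_piMr ?norm_delta_le1// ltW.
Qed.

Lemma diff_orthant (W : normedModType R) (f : 'rV[R]_M -> W) p :
  orthant p -> differentiable f p ->
  differentiable f (wnbhs p) /\ 'd f (wnbhs p) = 'd f p :> ('rV[R]_M -> W).
Proof.
move=> p0 df.
pose spec (l : {linear 'rV[R]_M -> W}) := continuous l /\ forall x,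
  f x = f (lim (wnbhs p)) + l (x - lim (wnbhs p))
        +o_(x \near wnbhs p) (x - lim (wnbhs p)).
have spec_d : spec ('d f p).
  have /diffP[cd dE] := df; split => //; rewrite wnbhs_lim//.
  suff H : f = (fun x => f p + 'd f p (x - p)) +o_ (wnbhs p) (fun x => x - p).
    by move=> x; exact: (congr1 (@^~ x) H).
  apply/eqaddoP => e e0; rewrite lim_id// in dE.
  by have /eqaddoP/(_ e e0) := funext dE; exact: cvg_within.
have spec_w : spec ('d f (wnbhs p)) := getPex (ex_intro spec _ spec_d).
split; first exact/diffP.
have uniq (l1 l2 : {linear 'rV[R]_M -> W}) : spec l1 -> spec l2 ->
    l1 = l2 :> ('rV[R]_M -> W).
  rewrite /spec wnbhs_lim// => -[_ /funext l1E] [_ /funext l2E].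
  apply: (orthant_linear_eq p0) => e e0.
  have e20 : 0 < e / 2 by rewrite divr_gt0.
  move/eqaddoP/(_ _ e20) : l1E; apply: filter_app.
  move/eqaddoP/(_ _ e20) : l2E; apply: filterS => x h2 h1.
  rewrite [e in leRHS](splitr e) mulrDl.
  apply: le_trans (lerD h2 h1); apply: le_trans (ler_normB _ _).
  by rewrite !fctE opprB [X in _ <= `|X|]addrC addrA subrK opprD addrACA subrr add0r.
exact: uniq.
Qed.

Lemma grad_ambient (f : 'rV[R]_M -> R) p : simplex p ->
  differentiable (f : 'rV[R]_M -> R^o) p ->
  grad f p = \row_i 'D_(delta_mx 0 i) (f : 'rV[R]_M -> R^o) p.
Proof.
move=> [p0 _] df; apply/rowP => i.
by rewrite !mxE (diff_orthant p0 df).2 deriveE.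
Qed.

End Euclidean.

Section LabelShift.
Context {R : realType} {dX : measure_display} {X : measurableType dX} {m : nat}.
Local Notation Y := 'I_m.+1.
Local Notation vec := 'rV[R]_m.+1.

Definition label_marginal (Q : probability (X * Y)%type R) : vec :=
  \row_i fine (Q (setT `*` [set i])).

(* Q(x \in A | y = i); meaningful when the label i has positive mass. *)
Definition class_cond (Q : probability (X * Y)%type R) (i : Y) (A : set X) : R :=
  fine (Q (A `*` [set i])) / label_marginal Q 0 i.

Definition same_class_cond (Q Q' : probability (X * Y)%type R) : Prop :=
  forall i, 0 < label_marginal Q 0 i -> 0 < label_marginal Q' 0 i ->
  forall A, measurable A -> class_cond Q i A = class_cond Q' i A.

Definition confusion (Q : probability (X * Y)%type R) (f : X -> Y) :
    'M[R]_m.+1 :=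
  \matrix_(i, j) class_cond Q i (f @^-1` [set j]).

Definition diagv (C : 'M[R]_m.+1) : vec := \row_i C i i.

(* A tie-breaking rule selects one label from the set of maximisers. *)
Definition tie_rule (tie : {set Y} -> Y) : Prop :=
  forall B : {set Y}, B != finset.set0 -> tie B \in B.

Definition argmax (tie : {set Y} -> Y) (s : Y -> R) : Y :=
  tie [set y | [forall z, s z <= s y]]%SET.

Variables (tie : {set Y} -> Y) (Q0 : probability (X * Y)%type R) (Pf0 : X -> vec).

Local Notation q0 := (label_marginal Q0).

Definition base_classifier (x : X) : Y := argmax tie (Pf0 x 0).

Definition reweighted (p : vec) (x : X) : Y :=
  argmax tie (fun y => p 0 y / q0 0 y * Pf0 x 0 y).

Definition diag_confusion (p : vec) : vec := diagv (confusion Q0 (reweighted p)).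

Definition loss (p q : vec) : R := dotv (const_mx 1 - diag_confusion p) q.

(* (C_{f0,Q0}^T)^-1 e_j, written as a row vector. *)
Definition qhat (j : Y) : vec :=
  (invmx (confusion Q0 base_classifier)^T *m (delta_mx 0 j)^T)^T.

(* Rounds are numbered from 0: [ogd eta xs t] is the iterate p_{t+1}, computed
   from the features x_1, .., x_t, which are [xs 0], .., [xs t.-1]. *)
Fixpoint ogd (eta : R) (xs : nat -> X) (t : nat) : vec :=
  if t is s.+1 then
    let p := ogd eta xs s in
    simplex_proj (p - eta *: grad (loss ^~ (qhat (base_classifier (xs s)))) p)
  else q0.

End LabelShift.

Definition mutually_independent (R : realType) (dW dS : measure_display)
    (W : measurableType dW) (S : measurableType dS) (P : probability W R)
    (I : finType) (Z : I -> {RV P >-> S}) : Prop :=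
  forall (J : {set I}) (A : I -> set S), (forall i, measurable (A i)) ->
  P (\bigcap_(i in [set` J]) Z i @^-1` A i) =
  (\prod_(i in J) P (Z i @^-1` A i))%E.

(* Main.v *)
(* Convexity bounds the regret of each round by the linearised regret
   <grad loss(.; q_t) (p_t), p_t - u>. The gradient is linear in q, the iterate
   p_t depends only on the samples before round t, and the estimator is unbiased
   (E[qhat_t] = q_t), so q_t may be replaced by qhat_t in expectation. For every
   outcome of the samples, the nonexpansiveness of the projection then bounds
   the linearised regret by 1 / eta + eta T L^2 / 2. As the iterates depend on
   the features only through the predicted labels f0(x_t), all expectations are
   finite sums over label sequences with product weights. *)
From HB Require Import structures.
Require Import Defs.
From mathcomp Require Import all_boot all_order all_algebra.
From mathcomp Require Import ring lra.
From mathcomp Require Import all_classical all_reals all_analysis.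
Import Order.TTheory GRing.Theory Num.Theory.
Import numFieldNormedType.Exports.
Local Open Scope classical_set_scope.
Local Open Scope ring_scope.

(** * Euclidean geometry of the simplex and projected gradient descent *)

Section EuclideanGeometry.
Context {R : realType} {M : nat}.
Implicit Types (u v w p q : 'rV[R]_M).

Lemma dotvC u v : dotv u v = dotv v u.
Proof. by apply: eq_bigr => i _; rewrite mulrC. Qed.

Lemma dotvDl u v w : dotv (u + v) w = dotv u w + dotv v w.
Proof. by rewrite -big_split; apply: eq_bigr => i _; rewrite mxE mulrDl. Qed.

Lemma dotvZl a u v : dotv (a *: u) v = a * dotv u v.
Proof.
by rewrite /dotv mulr_sumr; apply: eq_bigr => i _; rewrite mxE mulrA.
Qed.

Lemma dotvNl u v : dotv (- u) v = - dotv u v.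
Proof. by rewrite -scaleN1r dotvZl mulN1r. Qed.

Lemma dotvBl u v w : dotv (u - v) w = dotv u w - dotv v w.
Proof. by rewrite dotvDl dotvNl. Qed.

Lemma dotvBr u v w : dotv w (u - v) = dotv w u - dotv w v.
Proof. by rewrite dotvC dotvBl 2!(dotvC w). Qed.

Lemma dotvZr a u v : dotv u (a *: v) = a * dotv u v.
Proof. by rewrite dotvC dotvZl dotvC. Qed.

Lemma dotv_ge0 v : 0 <= dotv v v.
Proof. by apply: sumr_ge0 => i _; rewrite -expr2 sqr_ge0. Qed.

Lemma norm2_ge0 v : 0 <= norm2 v.
Proof. exact: sqrtr_ge0. Qed.

Lemma norm2_sqr v : norm2 v ^+ 2 = dotv v v.
Proof. by rewrite sqr_sqrtr ?dotv_ge0. Qed.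

Lemma norm2_eq0 v : norm2 v = 0 -> v = 0.
Proof.
move/(congr1 (fun x => x ^+ 2)); rewrite norm2_sqr expr0n /= => /eqP.
rewrite psumr_eq0 => [/allP v0|i _]; last by rewrite -expr2 sqr_ge0.
apply/rowP => i; rewrite mxE; apply/eqP.
by have := v0 i (mem_index_enum _); rewrite -expr2 sqrf_eq0.
Qed.

Lemma sqr_dotvB u v :
  dotv (u - v) (u - v) = dotv u u - 2 * dotv u v + dotv v v.
Proof. by rewrite dotvBl !dotvBr (dotvC v u); ring. Qed.

Lemma coord_le_norm v i : `|v 0 i| <= `|v|.
Proof.
rewrite [leRHS]/Num.norm /= mx_normrE.
exact: (@le_bigmax _ _ _ _ (fun ij : 'I_1 * 'I_M => `|v ij.1 ij.2|) (0, i)).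
Qed.

(** Hölder's inequality between the sup norm, in which remainders of derivatives are measured, and
    the l1 norm. *)
Lemma dotv_le_norm v q : `|dotv v q| <= `|v| * \sum_i `|q 0 i|.
Proof.
rewrite mulr_sumr; apply: le_trans (ler_norm_sum _ _ _) _.
apply: ler_sum => i _.
by rewrite normrM ler_wpM2r ?coord_le_norm.
Qed.

Lemma dotvl_continuous q : continuous (dotv ^~ q).
Proof.
apply: continuous_big => [|i _ p]; first exact: add_continuous.
apply: (@continuousM R _ (fun p => p 0 i) (fun=> q 0 i) p).
  exact: coord_continuous.
exact: cst_continuous.
Qed.

Lemma simplex_segment p q s : simplex p -> simplex q -> 0 <= s <= 1 ->
  simplex (p + s *: (q - p)).
Proof.
move=> [p0 p1] [q0 q1] /andP[s0 s1]; split=> [i|].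
  have -> : (p + s *: (q - p)) 0 i = (1 - s) * p 0 i + s * q 0 i.
    by rewrite !mxE; ring.
  by rewrite addr_ge0// mulr_ge0 ?p0 ?q0// subr_ge0.
rewrite (eq_bigr (fun i => (1 - s) * p 0 i + s * q 0 i)) => [|i _]; last first.
  by rewrite !mxE; ring.
by rewrite big_split /= -!mulr_sumr p1 q1; ring.
Qed.

Lemma simplex_le1 p i : simplex p -> p 0 i <= 1.
Proof.
by move=> [p0 <-]; rewrite (bigD1 i)//= lerDl sumr_ge0.
Qed.

(** In each coordinate (a - b)^2 <= a + b because a and b lie in [0, 1]; the right-hand sides add up
    to 2. *)
Lemma simplex_diameter p q : simplex p -> simplex q ->
  dotv (p - q) (p - q) <= 2.
Proof.
move=> sp sq; have [p0 p1] := sp; have [q0 q1] := sq.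
have -> : 2 = \sum_i (p 0 i + q 0 i) :> R by rewrite big_split /= p1 q1.
apply: ler_sum => i _; rewrite !mxE.
have := simplex_le1 p i sp; have := simplex_le1 q i sq.
have := p0 i; have := q0 i; set a := p 0 i; set b := q 0 i => b0 a0 b1 a1.
nra.
Qed.

Lemma compact_simplex : compact (@simplex R M).
Proof.
apply: bounded_closed_compact.
  exists 1; split=> // r r1 p sp; change (mx_norm p <= r); rewrite mx_normrE.
  have r0 : 0 <= r by rewrite ltW// (lt_trans ltr01).
  apply/bigmax_leP; split=> // -[k i] _ /=.
  rewrite ord1 ger0_norm; last exact: sp.1.
  by rewrite (le_trans (simplex_le1 p i sp))// ltW.
have -> : simplex = \bigcap_i ((fun p => p 0 i) @^-1` [set x : R | 0 <= x]) `&`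
    ((fun p => \sum_i p 0 i) @^-1` [set 1]).
  apply/seteqP; split=> p [h1 h2]; split=> // i; first by move=> _; exact: h1.
  exact: h1.
apply: closedI.
  apply: closed_bigI => i _; apply: closed_comp; last exact: closed_ge.
  by move=> p _; exact: coord_continuous.
apply: closed_comp; last exact: closed_eq.
move=> p _; apply: continuous_big => [|i _]; first exact: add_continuous.
exact: coord_continuous.
Qed.

(** [simplex_proj] is a chosen minimiser, so existence must be shown: a continuous function attains
    its minimum on a nonempty compact set, and [p] witnesses nonemptiness. *)
Lemma simplex_projP v p : simplex p -> simplex (simplex_proj v) /\
  forall q, simplex q -> norm2 (v - simplex_proj v) <= norm2 (v - q).
Proof.
move=> sp; apply: (@getPex _ [set p | simplex p /\
    forall p', simplex p' -> norm2 (v - p) <= norm2 (v - p')]).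
have cn : continuous (fun q => norm2 (v - q)).
  move=> q; apply: (@continuous_comp _ _ _ (fun q => dotv (v - q) (v - q))
    Num.sqrt); last exact: sqrt_continuous.
  apply: continuous_big => [|i _ {}q]; first exact: add_continuous.
  have vq : {for q, continuous (fun x : 'rV[R]_M => (v - x) 0 i)}.
    apply: (@continuous_comp _ _ _ (fun x : 'rV[R]_M => v - x)
      (fun w : 'rV[R]_M => w 0 i) q).
      by apply: continuousB; [exact: cst_continuous | exact: cvg_id].
    exact: coord_continuous.
  exact: (@continuousM R _ (fun x : 'rV[R]_M => (v - x) 0 i)
    (fun x : 'rV[R]_M => (v - x) 0 i) q).
have [||c cS cmin] := @EVT_min_rV R M (fun q => norm2 (v - q)) simplex _
    compact_simplex.
- by exists p.
- exact: continuous_subspaceT.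
exists c; split; first exact: set_mem.
by move=> q sq; apply: cmin; exact: mem_set.
Qed.

(** With [u] the projection of [v], the variational inequality <v - u, p - u> <= 0 holds; expanding
    |v - p|^2 around [u] then leaves at least |u - p|^2. *)
Lemma simplex_proj_contract v p : simplex p ->
  dotv (simplex_proj v - p) (simplex_proj v - p) <= dotv (v - p) (v - p).
Proof.
move=> sp; have [su umin] := simplex_projP v p sp.
set u := simplex_proj v in su umin *.
suff obtuse : dotv (v - u) (p - u) <= 0.
  have := dotv_ge0 (v - u).
  have -> : v - p = (v - u) - (p - u) by rewrite opprB addrA subrK.
  rewrite (sqr_dotvB (v - u)) -(opprB p u) dotvNl dotvC dotvNl opprK.
  by lra.
set a := dotv _ _; set b := dotv (p - u) (p - u).
(* Minimality of [u] against the point at parameter [s] of the segment from [u] to [p], after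
   division by [s]. *)
have key s : 0 < s <= 1 -> 2 * a <= s * b.
  move=> /andP[s0 s1].
  have /umin : simplex (u + s *: (p - u)).
    by apply: simplex_segment; rewrite // ltW.
  rewrite -(@ler_pXn2r _ 2)// ?nnegrE ?norm2_ge0// !norm2_sqr opprD addrA.
  rewrite (sqr_dotvB (v - u)) dotvZl !dotvZr -/a -/b => h.
  have : s * (2 * a) <= s * (s * b) by nra.
  by rewrite ler_pM2l.
rewrite leNgt; apply/negP => a0.
have b0 : 0 <= b by exact: dotv_ge0.
(* If a > 0, this parameter gives 2 a (a + b) <= a b, impossible since b >= 0. *)
have := key (a / (a + b)); rewrite ler_pdivrMr ?divr_gt0 ?ltr_wpDr//= mul1r.
rewrite lerDl => /(_ b0).
by rewrite mulrAC ler_pdivlMr ?ltr_wpDr//; nra.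
Qed.

(** Each step satisfies |p_(t+1) - u|^2 <= |p_t - u|^2 - 2 eta <g_t, p_t - u> + eta^2 |g_t|^2, and
    these inequalities telescope. *)
Lemma ogd_regret (eta : R) (p g : nat -> 'rV[R]_M) u T : simplex (p 0%N) ->
  simplex u -> (forall t, p t.+1 = simplex_proj (p t - eta *: g t)) ->
  2 * eta * \sum_(t < T) dotv (g t) (p t - u) <=
    2 + eta ^+ 2 * \sum_(t < T) dotv (g t) (g t).
Proof.
move=> sp su pS; have := simplex_diameter _ _ sp su.
(* Keeping the last squared distance on the left makes the induction on [T] go through. *)
suff : 2 * eta * \sum_(t < T) dotv (g t) (p t - u)
    + dotv (p T - u) (p T - u) <=
  dotv (p 0%N - u) (p 0%N - u) + eta ^+ 2 * \sum_(t < T) dotv (g t) (g t).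
  by have := dotv_ge0 (p T - u); lra.
elim: T => [|T IH]; first by rewrite !big_ord0; lra.
have := simplex_proj_contract (p T - eta *: g T) u su; rewrite -pS.
rewrite addrAC (sqr_dotvB (p T - u)) dotvZl !dotvZr (dotvC (p T - u) (g T)).
rewrite !big_ord_recr /= !mulrDr expr2; lra.
Qed.

End EuclideanGeometry.

(** * Derivatives along increments that stay in the orthant *)

Section OrthantGradient.
Context {R : realType} {M : nat}.
Implicit Types (p q u : 'rV[R]_M).

(** Explicit epsilon form of differentiability, free of the chosen little-o remainder. *)
Definition orthant_diff (W : normedModType R) (f : 'rV[R]_M -> W)
    (l : {linear 'rV[R]_M -> W}) p :=
  forall e, 0 < e -> \forall x \near wnbhs p,
    `|f x - f p - l (x - p)| <= e * `|x - p|.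

Lemma differentiable_orthant_diff (W : normedModType R) (f : 'rV[R]_M -> W) p :
  orthant p -> differentiable f (wnbhs p) ->
  orthant_diff W f ('d f (wnbhs p)) p.
Proof.
move=> p0 /diffP[_]; rewrite wnbhs_lim// => /funext dE e e0.
move/eqaddoP/(_ _ e0) : dE; apply: filterS => x.
by rewrite !fctE opprD addrA.
Qed.

(** Two candidate derivatives differ by at most e |x - p| near [p] in the orthant, for every e > 0,
    and the increments available there span the space. *)
Lemma orthant_diff_unique (W : normedModType R) (f : 'rV[R]_M -> W)
    (l : {linear 'rV[R]_M -> W}) p :
  orthant p -> continuous l -> orthant_diff W f l p ->
  'd f (wnbhs p) = l :> ('rV[R]_M -> W).
Proof.
move=> p0 lc lf.
pose spec (l : {linear 'rV[R]_M -> W}) := continuous l /\ forall x,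
  f x = f (lim (wnbhs p)) + l (x - lim (wnbhs p))
        +o_(x \near wnbhs p) (x - lim (wnbhs p)).
have spec_l : spec l.
  split=> //; rewrite wnbhs_lim//.
  suff H : f = (fun x => f p + l (x - p)) +o_ (wnbhs p) (fun x => x - p).
    by move=> x; exact: (congr1 (@^~ x) H).
  apply/eqaddoP => e e0; apply: filterS (lf e e0) => x.
  by rewrite !fctE opprD addrA.
(* ['d] is obtained by choice; since [l] meets the specification, so does the chosen map. *)
have spec_d : spec ('d f (wnbhs p)) := getPex (ex_intro spec _ spec_l).
have df : differentiable f (wnbhs p) by exact/diffP.
apply: (orthant_linear_eq p0) => e e0.
have e20 : 0 < e / 2 by rewrite divr_gt0.
have := differentiable_orthant_diff W f p p0 df _ e20.
apply: filter_app; move: (lf _ e20); apply: filterS => x h2 h1.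
rewrite [e in leRHS](splitr e) mulrDl.
apply: le_trans (lerD h2 h1); apply: le_trans (ler_normB _ _).
by rewrite opprB [X in _ <= `|X|]addrC addrA subrK.
Qed.

Lemma gradE (f : 'rV[R]_M -> R) (l : {linear 'rV[R]_M -> R^o}) p u :
  orthant p -> continuous l -> orthant_diff R^o f l p ->
  dotv (grad f p) u = l u.
Proof.
move=> p0 lc lf; rewrite [in RHS](row_sum_delta u) linear_sum.
apply: eq_bigr => i _; rewrite mxE linearZ mulrC.
by rewrite (orthant_diff_unique _ _ _ p p0 lc lf).
Qed.

(** On the segment from [p] to [u], the chord bounds [f] from above and the tangent bounds it from
    below up to a small error; dividing by the parameter [s] compares the two at [u]. *)
Lemma convex_ge_tangent (f : 'rV[R]_M -> R) (l : {linear 'rV[R]_M -> R^o}) p u :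
  simplex p -> simplex u -> convex_function simplex (f : 'rV[R]_M -> R^o) ->
  orthant_diff R^o f l p -> f p + l (u - p) <= f u.
Proof.
move=> sp su cf lf; apply/ler_addgt0Pr => e e0.
(* The added 1 keeps [c] positive when u = p; the tolerance e / c then costs at most e along u -
   p. *)
set c := `|u - p| + 1; have c0 : 0 < c by rewrite ltr_wpDl.
have := lf (e / c) (divr_gt0 e0 c0).
rewrite /wnbhs /within /= => /nbhs_ballP[r /= r0 rP].
(* s <= 1 keeps the point on the segment, and s |u - p| <= r / 2 keeps it in the ball. *)
pose s := Num.min 1 (r / c / 2).
have s0 : 0 < s by rewrite lt_min ltr01 !divr_gt0.
have s1 : s <= 1 by rewrite ge_min lexx.
have sr : s * `|u - p| < r.
  apply: (@le_lt_trans _ _ (r / 2)); last first.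
    by rewrite ltr_pdivrMr// ltr_pMr// ltr1n.
  apply: (@le_trans _ _ (r / c / 2 * c)).
    apply: ler_pM => //; first exact: ltW.
      by rewrite ge_min lexx orbT.
    by rewrite lerDl.
  by rewrite mulrAC divfK ?gt_eqF.
have s01 : 0 <= s <= 1 by rewrite ltW.
have sx : simplex (p + s *: (u - p)) by exact: simplex_segment.
have : f (p + s *: (u - p)) <= s * f u + (1 - s) * f p.
  pose t : {i01 R} := Itv01 (ltW s0) s1.
  have := cf t u p (mem_set su) (mem_set sp).
  rewrite convRE /=; apply: le_trans.
  rewrite le_eqVlt; apply/orP; left; apply/eqP.
  congr f; rewrite -[RHS]/(s *: u + (1 - s) *: p) scalerBl scale1r scalerBr.
  by rewrite addrCA.
have /rP /(_ sx.1) : ball p r (p + s *: (u - p)).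
  rewrite -ball_normE/= opprD addNKr normrN normrZ gtr0_norm//.
rewrite [p + _ - p]addrC addKr linearZ normrZ (gtr0_norm s0) mulrCA.
rewrite ler_norml => /andP[+ _] => h1 h2.
have h3 : e / c * `|u - p| <= e.
  by rewrite mulrAC ler_pdivrMr// ler_pM2l// lerDl.
suff : s * (f p + l (u - p)) <= s * (f u + e) by rewrite ler_pM2l.
have : s * (e / c * `|u - p|) <= s * e by rewrite ler_pM2l.
by move: h1; rewrite -[X in f _ - f p - X]/(s * l (u - p)); lra.
Qed.

End OrthantGradient.

(** * The gradient of the loss *)

Section LossGradient.
Context {R : realType} {dX : measure_display} {X : measurableType dX} {m : nat}.
Variables (tie : {set 'I_m.+1} -> 'I_m.+1)
  (Q0 : probability (X * 'I_m.+1)%type R) (Pf0 : X -> 'rV[R]_m.+1).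
Variables (p : 'rV[R]_m.+1) (sp : simplex p)
  (dp : differentiable (diag_confusion tie Q0 Pf0) (wnbhs p)).
Implicit Types q u v : 'rV[R]_m.+1.

Local Notation loss := (loss tie Q0 Pf0).
Local Notation D := ('d (diag_confusion tie Q0 Pf0) (wnbhs p)).

(** The loss is affine in the diagonal of the confusion matrix, so its derivative is read off from
    that of the diagonal. *)
Let loss_diff q v : R^o := - dotv (D v) q.

Let loss_diff_linear q : linear (loss_diff q).
Proof.
move=> a u v; by rewrite /loss_diff linearP dotvDl dotvZl opprD -mulrN.
Qed.

HB.instance Definition _ q := GRing.isLinear.Build R 'rV[R]_m.+1 R^o *:%R
  (loss_diff q) (loss_diff_linear q).

Let loss_diff_continuous q : continuous (loss_diff q).
Proof.
have /diffP[cD _] := dp.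
move=> v; apply: (@continuousN _ R^o _ (dotv ^~ q \o D)).
by apply: continuous_comp; [exact: cD | exact: dotvl_continuous].
Qed.

Let loss_orthant_diff q : orthant_diff R^o (loss ^~ q) (loss_diff q) p.
Proof.
(* [c] dominates the l1 norm of [q], so an error e / c in the diagonal costs at most e after pairing
   with [q]. *)
move=> e e0; set c := \sum_i `|q 0 i| + 1.
have c0 : 0 < c by rewrite ltr_wpDl// sumr_ge0.
have := differentiable_orthant_diff _ _ p sp.1 dp (e / c) (divr_gt0 e0 c0).
apply: filterS => x.
set v := _ - _ - _ => h.
have -> : loss x q - loss p q - loss_diff q (x - p) = - dotv v q.
  by rewrite /loss_diff /loss /v !dotvBl opprK; ring.
rewrite normrN; apply: le_trans (dotv_le_norm _ _) _.
apply: (@le_trans _ _ (e / c * `|x - p| * c)).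
  by apply: ler_pM => //; rewrite ?sumr_ge0// lerDl.
by rewrite mulrAC divfK ?gt_eqF.
Qed.

(** The right-hand side is linear in [q], which lets averages over the estimates pass through the
    gradient. *)
Lemma grad_lossE q u : dotv (grad (loss ^~ q) p) u = - dotv (D u) q.
Proof.
exact: (gradE _ _ p u sp.1 (loss_diff_continuous q) (loss_orthant_diff q)).
Qed.

(** Convexity is asked at the given [q] alone: it is available for [q] in the simplex, which the
    estimates [qhat] may leave. *)
Lemma loss_ge_tangent q u : simplex u ->
  convex_function simplex (fun p => loss p q : R^o) ->
  loss p q + dotv (grad (loss ^~ q) p) (u - p) <= loss u q.
Proof.
move=> su cf; rewrite grad_lossE.
exact: (convex_ge_tangent _ _ p u sp su cf (loss_orthant_diff q)).
Qed.

End LossGradient.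

(** * Measurability of predictions and the law of the predicted label *)

(** The classifier factors through the set of maximisers, which takes finitely many values, each cut
    out by finitely many comparisons of scores. This covers every choice of [tie]. *)
Lemma measurable_base_classifier {R : realType} {dX : measure_display}
    {X : measurableType dX} {m : nat} (tie : {set 'I_m.+1} -> 'I_m.+1)
    (Pf0 : X -> 'rV[R]_m.+1) (A : set 'I_m.+1) :
  (forall y, measurable_fun [set: X] (fun x => Pf0 x 0 y)) ->
  measurable (base_classifier tie Pf0 @^-1` A).
Proof.
move=> mP; pose B x := [set y | [forall z, Pf0 x 0 z <= Pf0 x 0 y]]%SET.
have mle z y : measurable [set x | Pf0 x 0 z <= Pf0 x 0 y].
  by have := measurable_fun_le measurableT (mP z) (mP y); rewrite setTI.
have mB y : measurable [set x | y \in B x].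
  rewrite [X in measurable X](_ : _ =
      \bigcap_(z in [set: 'I_m.+1]) [set x | Pf0 x 0 z <= Pf0 x 0 y]).
    by apply: fin_bigcap_measurable => // ? _; exact: mle.
  apply/seteqP; split=> x /=; rewrite inE.
    by move/forallP => h z _; exact: h.
  by move=> h; apply/forallP => z; exact: h.
have mS S : measurable [set x | B x = S].
  rewrite [X in measurable X](_ : _ = \bigcap_(y in [set: 'I_m.+1])
      (if y \in S then [set x | y \in B x] else ~` [set x | y \in B x])).
    apply: fin_bigcap_measurable => // y _; case: ifP => _ //.
    exact: measurableC.
  apply/seteqP; split=> x /=.
    by move=> <- y _; case: ifPn => // /negP.
  move=> h; apply/setP => y; have := h y I; case: ifP => //= _ /negP.
  exact: negbTE.
rewrite [X in measurable X](_ : _ =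
    \bigcup_(S in [set S | A (tie S)]) [set x | B x = S]).
  by apply: fin_bigcup_measurable => // S _; exact: mS.
apply/seteqP; split=> x /=; first by exists (B x).
by move=> [S + BxS]; rewrite -BxS.
Qed.

Section LabelMarginal.
Context {R : realType} {dX : measure_display} {X : measurableType dX} {m : nat}.
Variable Q : probability (X * 'I_m.+1)%type R.

Lemma measurable_setX1 (A : set X) (i : 'I_m.+1) :
  measurable A -> measurable (A `*` [set i]).
Proof. by move=> mA; exact: measurableX. Qed.

Lemma prob_labelE (A : set X) : measurable A ->
  fine (Q (A `*` setT)) = \sum_i fine (Q (A `*` [set i])).
Proof.
move=> mA; rewrite sum_fine => [|i _]; last first.
  by apply: fin_num_measure; exact: measurable_setX1.
congr fine; rewrite -(@measure_bigsetU_ord _ _ _ Q _ xpredT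
  (fun i : 'I_m.+1 => A `*` [set i])).
- congr (Q _); apply/seteqP; split=> -[x i] /=.
    by move=> [Ax _]; rewrite (bigD1 i)//=; left.
  by elim/big_ind: _ => [//|B C hB hC [/hB|/hC]//|k _ []].
- by move=> i; exact: measurable_setX1.
- by move=> i k _ _ [[x y] [[_ /= ->] [_ /= ->]]].
Qed.


Lemma label_marginal_simplex : simplex (label_marginal Q).
Proof.
split=> [i|]; first by rewrite mxE fine_ge0.
under eq_bigr do rewrite mxE.
by rewrite -prob_labelE// setXTT probability_setT.
Qed.

(** For a label of mass zero the quotient in [class_cond] is a default value, but the joint mass
    then vanishes by monotonicity, so the product formula persists. *)
Lemma joint_class_cond (i : 'I_m.+1) (A : set X) : measurable A ->
  fine (Q (A `*` [set i])) = label_marginal Q 0 i * class_cond Q i A.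
Proof.
move=> mA; rewrite /class_cond mulrC.
have [q0|q0] := eqVneq (label_marginal Q 0 i) 0; last by rewrite divfK.
rewrite q0 mulr0; apply/eqP; rewrite eq_le fine_ge0// andbT -q0 mxE.
apply: fine_le; rewrite ?fin_num_measure//; try exact: measurable_setX1.
by apply: le_measure; rewrite ?inE; [exact: measurable_setX1..|move=> x []].
Qed.

End LabelMarginal.

(** Total probability over the true label. Labels of mass zero under [Q] contribute nothing, so
    class-conditionals are compared only where both laws give positive mass. *)
Lemma prediction_law {R : realType} {dX : measure_display}
    {X : measurableType dX} {m : nat} (Q Q0 : probability (X * 'I_m.+1)%type R)
    (f : X -> 'I_m.+1) (j : 'I_m.+1) :
  (forall A, measurable (f @^-1` A)) -> (forall i, 0 < label_marginal Q0 0 i) ->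
  same_class_cond Q Q0 ->
  fine (Q ((f @^-1` [set j]) `*` setT)) =
    (label_marginal Q *m confusion Q0 f) 0 j.
Proof.
move=> mf q0 same; rewrite prob_labelE// mxE; apply: eq_bigr => i _.
rewrite joint_class_cond// [confusion _ _ _ _]mxE.
have := (label_marginal_simplex Q).1 i; rewrite le_eqVlt => /orP[/eqP<-|qi].
  by rewrite !mul0r.
by rewrite same.
Qed.

(** The integrand is a finite linear combination of indicators of the events [J w = i]. *)
Lemma expectation_fin {R : realType} {dW : measure_display}
    {W : measurableType dW} (P : probability W R) (I : finType) (J : W -> I)
    (F : I -> R) : (forall i, measurable (J @^-1` [set i])) ->
  ('E_P[(fun w => F (J w))] = (\sum_i F i * fine (P (J @^-1` [set i])))%:E)%E.
Proof.
move=> mJ; rewrite unlock.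
transitivity (\int[P]_w (\sum_i (F i)%:E * (\1_(J @^-1` [set i]) w)%:E))%E.
  apply: eq_integral => w _; rewrite sumEFin; congr EFin.
  rewrite (bigD1 (J w))//= indicE mem_set// mulr1 big1 ?addr0// => i ij.
  by rewrite indicE memNset ?mulr0//= => Ji; rewrite Ji eqxx in ij.
rewrite integral_sum//= => [|i]; last first.
  by apply: integrableZl => //; exact: integrable_indic.
rewrite -sumEFin; apply: eq_bigr => i _.
rewrite integralZl//; last exact: integrable_indic.
by rewrite integral_indic// setIT EFinM fineK// fin_num_measure.
Qed.

(** * Product weights on label sequences *)

Section ProductWeights.
Context {R : realType} {m n : nat}.
Variable law : 'I_n -> 'I_m.+1 -> R.
Hypothesis law1 : forall t, \sum_j law t j = 1.

Definition weight (a : {ffun 'I_n -> 'I_m.+1}) : R := \prod_t law t (a t).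

Lemma sum_weight : \sum_a weight a = 1.
Proof. by rewrite -bigA_distr_bigA big1. Qed.

Definition upd (a : {ffun 'I_n -> 'I_m.+1}) t j : {ffun 'I_n -> 'I_m.+1} :=
  [ffun s => if s == t then j else a s].

(* Exchanging [a t] with an independent copy [j] preserves the joint weight. *)
Lemma sum_weight_resample t (f : 'I_m.+1 -> {ffun 'I_n -> 'I_m.+1} -> R) :
  (forall j a k, f j (upd a t k) = f j a) ->
  \sum_a weight a * f (a t) a = \sum_a weight a * \sum_j law t j * f j a.
Proof.
move=> fupd.
pose sw (x : {ffun 'I_n -> 'I_m.+1} * 'I_m.+1) := (upd x.1 t x.2, x.1 t).
have swK : involutive sw.
  move=> [a j]; rewrite /sw /= ffunE eqxx; congr pair.
  by apply/ffunP => s; rewrite !ffunE; case: eqP => // ->.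
transitivity (\sum_(x : {ffun 'I_n -> 'I_m.+1} * 'I_m.+1)
    weight x.1 * law t x.2 * f (x.1 t) x.1).
  rewrite -(pair_bigA _ (fun a j => weight a * law t j * f (a t) a)) /=.
  by apply: eq_bigr => a _; rewrite -mulr_suml -mulr_sumr law1 mulr1.
rewrite (reindex_inj (inv_inj swK)) /=.
transitivity (\sum_(x : {ffun 'I_n -> 'I_m.+1} * 'I_m.+1)
    weight x.1 * (law t x.2 * f x.2 x.1)).
  apply: eq_bigr => -[a j] _ /=; rewrite fupd ffunE eqxx mulrA; congr (_ * _).
  rewrite /weight (bigD1 t)//= [in RHS](bigD1 t)//= ffunE eqxx.
  rewrite (eq_bigr (fun s => law s (a s))) => [|s /negbTE st]; first by ring.
  by rewrite ffunE st.
rewrite -(pair_bigA _ (fun a j => weight a * (law t j * f j a))) /=.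
by apply: eq_bigr => a _; rewrite mulr_sumr.
Qed.

End ProductWeights.

(** * Gradient descent along sequences of predicted labels *)

Section LabelDrivenOGD.
Context {R : realType} {dX : measure_display} {X : measurableType dX} {m : nat}.
Variables (tie : {set 'I_m.+1} -> 'I_m.+1)
  (Q0 : probability (X * 'I_m.+1)%type R) (Pf0 : X -> 'rV[R]_m.+1).
Variable eta : R.

Local Notation loss := (loss tie Q0 Pf0).
Local Notation qhat := (qhat tie Q0 Pf0).
Local Notation f0 := (base_classifier tie Pf0).

Lemma qhatE j : qhat j = row j (invmx (confusion Q0 f0)).
Proof. by rewrite /Defs.qhat trmx_mul -trmx_inv !trmxK -rowE. Qed.

(** Unbiasedness of the estimator, tested against [v]: [qhat j] is row j of C^-1, and (q C) C^-1 =
    q. *)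
Lemma mean_qhat (v q : 'rV[R]_m.+1) : confusion Q0 f0 \in unitmx ->
  \sum_j (q *m confusion Q0 f0) 0 j * dotv v (qhat j) = dotv v q.
Proof.
move=> Cu; set c := q *m _; under eq_bigr do rewrite mulr_sumr.
rewrite exchange_big; apply: eq_bigr => k _ /=.
rewrite -[q](mulmxK Cu) -/c [in RHS]mxE mulr_sumr; apply: eq_bigr => j _.
by rewrite qhatE [row _ _ _ _]mxE mulrCA.
Qed.

(* The iterates depend on the features only through the predicted labels,
   so they take finitely many values. *)
Fixpoint ogd_labels (js : nat -> 'I_m.+1) (t : nat) : 'rV[R]_m.+1 :=
  if t is s.+1 then
    let p := ogd_labels js s in
    simplex_proj (p - eta *: grad (loss ^~ (qhat (js s))) p)
  else label_marginal Q0.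

Lemma ogd_labelsE xs t : ogd tie Q0 Pf0 eta xs t = ogd_labels (f0 \o xs) t.
Proof.
elim: t => [|t IH]; first exact: erefl.
exact: (congr1 (fun p =>
  simplex_proj (p - eta *: grad (loss ^~ (qhat (f0 (xs t)))) p)) IH).
Qed.

(** The iterate of round [t] reads only earlier labels, which is what later allows the label of
    round [t] to be resampled. *)
Lemma eq_ogd_labels js js' t : (forall s, (s < t)%N -> js s = js' s) ->
  ogd_labels js t = ogd_labels js' t.
Proof.
elim: t => [_|t IH e]; first exact: erefl.
have et : js t = js' t by apply: e.
have IHt : ogd_labels js t = ogd_labels js' t.
  by apply: IH => s st; apply: e; rewrite ltnS ltnW.
by rewrite /= et IHt.
Qed.

Lemma ogd_labels_simplex js t : simplex (ogd_labels js t).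
Proof.
have s0 := label_marginal_simplex Q0.
by case: t => [|t]; [exact: s0 | exact: (simplex_projP _ _ s0).1].
Qed.

(** With s = sqrt(2 / T), the choice eta = s / L balances 1 / eta against eta T L^2 / 2: each equals
    T s L / 2. *)
Lemma ogd_labels_regret L T (js : nat -> 'I_m.+1) u : (0 < T)%N -> simplex u ->
  (forall p i, simplex p -> norm2 (grad (loss ^~ (qhat i)) p) <= L) ->
  eta = Num.sqrt (2 / T%:R) * (1 / L) ->
  \sum_(t < T) dotv (grad (loss ^~ (qhat (js t))) (ogd_labels js t))
                    (ogd_labels js t - u) <= T%:R * (Num.sqrt (2 / T%:R) * L).
Proof.
move=> T0 su gL etaE; pose p := ogd_labels js.
pose g t := grad (loss ^~ (qhat (js t))) (p t).
have gtL t : norm2 (g t) <= L by apply: gL; exact: ogd_labels_simplex.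
have L0 : 0 <= L by exact: le_trans (norm2_ge0 _) (gtL 0%N).
have Tr : 0 < T%:R :> R by rewrite ltr0n.
set s := Num.sqrt _ in etaE *.
have s0 : 0 < s by rewrite sqrtr_gt0 divr_gt0.
have ss : s ^+ 2 * T%:R = 2 by rewrite sqr_sqrtr ?divfK ?gt_eqF ?divr_ge0// ltW.
(* At L = 0 the junk value 1 / 0 = 0 gives eta = 0, but all gradients vanish. *)
have [L_0|Ln0] := eqVneq L 0.
  rewrite big1 ?L_0 ?mulr0// => t _; rewrite -/p -/(g t).
  have -> : g t = 0.
    by apply/norm2_eq0/eqP; rewrite eq_le norm2_ge0 -L_0 gtL.
  by rewrite -(scale0r 0) dotvZl mul0r.
have Lp : 0 < L by rewrite lt_neqAle eq_sym Ln0.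
have eta0 : 0 < eta by rewrite etaE mulr_gt0// divr_gt0.
have := ogd_regret eta p g u T (ogd_labels_simplex js 0) su (fun=> erefl).
set S := \sum_(t < T) _; set G := \sum_(t < T) _ => h.
have GL : G <= T%:R * L ^+ 2.
  rewrite mulr_natl -[X in _ *+ X]card_ord -sumr_const; apply: ler_sum => t _.
  by rewrite -norm2_sqr ler_pXn2r// nnegrE ?norm2_ge0.
rewrite -[leLHS]/S -(@ler_pM2l _ (2 * eta)) ?mulr_gt0//; apply: le_trans h _.
have e2G : eta ^+ 2 * G <= eta ^+ 2 * (T%:R * L ^+ 2).
  by rewrite ler_pM2l// exprn_gt0.
(* Since s^2 T = 2, both bounds become 4 once multiplied by [2 * eta]. *)
have sL : eta * L = s by rewrite etaE; field.
have -> : 2 * eta * (T%:R * (s * L)) = 2 * (s ^+ 2 * T%:R).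
  by rewrite -sL; ring.
have : eta ^+ 2 * (T%:R * L ^+ 2) = s ^+ 2 * T%:R by rewrite -sL; ring.
lra.
Qed.

Hypothesis diff_C : forall p : 'rV[R]_m.+1, simplex p ->
  differentiable (diag_confusion tie Q0 Pf0) (within orthant (nbhs p)).

(** The regret bound in finite form, before division by the number of rounds: the weights are built
    from the laws q_t C of the predicted labels. *)
Lemma weighted_regret n (q : nat -> 'rV[R]_m.+1) L (u : 'rV[R]_m.+1) :
  confusion Q0 f0 \in unitmx ->
  (forall q : 'rV[R]_m.+1, simplex q ->
    convex_function simplex (fun p => loss p q : R^o)) ->
  (forall p i, simplex p -> norm2 (grad (loss ^~ (qhat i)) p) <= L) ->
  eta = Num.sqrt (2 / n.+1%:R) * (1 / L) ->
  (forall t, simplex (q t)) -> simplex u ->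
  (forall (t : 'I_n.+1) j, 0 <= (q t *m confusion Q0 f0) 0 j) ->
  (forall t : 'I_n.+1, \sum_j (q t *m confusion Q0 f0) 0 j = 1) ->
  \sum_a weight (fun (t : 'I_n.+1) j => (q t *m confusion Q0 f0) 0 j) a *
    \sum_(t < n.+1) loss (ogd_labels (fun s => a (inord s)) t) (q t) <=
  \sum_(t < n.+1) loss u (q t) + n.+1%:R * (Num.sqrt (2 / n.+1%:R) * L).
Proof.
move=> Cu cvx gL etaE sq su law0 law1.
set w := weight _.
(* [inord] extends a finite sequence to all indices; the rounds in the sums read only indices up to
   [n]. *)
pose p (a : {ffun 'I_n.+1 -> 'I_m.+1}) t := ogd_labels (fun s => a (inord s)) t.
have sp a t : simplex (p a t) by exact: ogd_labels_simplex.
have w0 a : 0 <= w a by apply: prodr_ge0 => t _; exact: law0.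
have w1 : \sum_a w a = 1 by exact: sum_weight.
pose h a (t : nat) v := dotv (grad (loss ^~ v) (p a t)) (p a t - u).
(* For fixed [j], the term at [qhat j] does not depend on [a t], so [a t] may be replaced by an
   independent copy; averaging over the copy turns [qhat] into [q t]. *)
have mean (t : 'I_n.+1) :
    \sum_a w a * h a t (q t) = \sum_a w a * h a t (qhat (a t)).
  pose f j a := h a t (qhat j).
  have fupd j a k : f j (upd a t k) = f j a.
    have -> : f j (upd a t k) = dotv (grad (loss ^~ (qhat j)) (p (upd a t k) t))
      (p (upd a t k) t - u) by [].
    have -> : p (upd a t k) t = p a t; last by [].
    apply: eq_ogd_labels => s st; rewrite ffunE.
    case: eqP => // /(congr1 val) /=.
    rewrite inordK ?(ltn_trans st)// => e.
    by rewrite e ltnn in st.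
  apply: etrans (esym (sum_weight_resample _ law1 t f fupd)).
  apply: eq_bigr => a _; congr (_ * _).
  rewrite /h grad_lossE//; last exact: diff_C.
  rewrite -(mean_qhat _ _ Cu) -sumrN; apply: eq_bigr => j _.
  by rewrite /f /h grad_lossE ?mulrN//; exact: diff_C.
have path a : \sum_(t < n.+1) h a t (qhat (a t)) <=
    n.+1%:R * (Num.sqrt (2 / n.+1%:R) * L).
  have -> : \sum_(t < n.+1) h a t (qhat (a t)) =
      \sum_(t < n.+1) h a t (qhat (a (inord t))).
    by apply: eq_bigr => t _; rewrite inord_val.
  exact: (ogd_labels_regret L n.+1 (fun s => a (inord s)) u isT su gL etaE).
have tangent a t : loss (p a t) (q t) <= loss u (q t) + h a t (q t).
  have := loss_ge_tangent tie Q0 Pf0 _ (sp a t) (diff_C _ (sp a t)) (q t) u su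
    (cvx _ (sq t)).
  by rewrite dotvBr /h dotvBr; lra.
apply: (@le_trans _ _ (\sum_a w a * (\sum_(t < n.+1) loss u (q t)
    + \sum_(t < n.+1) h a t (q t)))).
  apply: ler_sum => a _; apply: ler_wpM2l => //.
  by rewrite -big_split; apply: ler_sum => t _; exact: tangent.
under eq_bigr do rewrite mulrDr.
rewrite big_split /= -mulr_suml w1 mul1r lerD2l.
under eq_bigr do rewrite mulr_sumr.
(* Round by round the true marginals become estimates; exchanging the sums back leaves the regret of
   a single label sequence, bounded by [path]. *)
rewrite exchange_big /= (eq_bigr _ (fun t _ => mean t)) exchange_big /=.
rewrite -[leRHS]mul1r -[X in X * _]w1 mulr_suml; apply: ler_sum => a _.
by rewrite -mulr_sumr; apply: ler_wpM2l.
Qed.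

End LabelDrivenOGD.

(** * From the probability space to label sequences *)

Lemma sum_prediction_prob {R : realType} {dX : measure_display}
    {X : measurableType dX} {m : nat} (Q : probability (X * 'I_m.+1)%type R)
    (f : X -> 'I_m.+1) : (forall A, measurable (f @^-1` A)) ->
  \sum_j fine (Q ((f @^-1` [set j]) `*` setT)) = 1.
Proof.
move=> mf.
have mJ j : measurable ((fun z : X * 'I_m.+1 => f z.1) @^-1` [set j]).
  rewrite [X in measurable X](_ : _ = (f @^-1` [set j]) `*` setT); last first.
    by apply/seteqP; split=> -[x y] //= [].
  exact: measurableX.
(* The constant 1 is viewed as a function of the predicted label, and its expectation is 1. *)
have := expectation_fin Q _ (fun z => f z.1) (fun=> 1) mJ.
rewrite expectation_cst => -[e]; rewrite [RHS]e; apply: eq_bigr => j _.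
rewrite mul1r; congr (fine (Q _)).
by apply/seteqP; split=> -[x y] //= [].
Qed.

Theorem theorem2 (R : realType) (dX dW : measure_display)
    (X : measurableType dX) (m T : nat)
    (tie : {set 'I_m.+1} -> 'I_m.+1)
    (Q0 : probability (X * 'I_m.+1)%type R)
    (Q : nat -> probability (X * 'I_m.+1)%type R)
    (Pf0 : X -> 'rV[R]_m.+1)
    (W : measurableType dW) (P : probability W R)
    (Z : nat -> {RV P >-> (X * 'I_m.+1)%type})
    (L eta : R)
    (T_gt0 : (0 < T)%N)
    (tieP : tie_rule tie)
    (Q0_pos : forall i, 0 < label_marginal Q0 0 i)
    (label_shift : forall t, (t < T)%N -> same_class_cond (Q t) Q0)
    (Pf0_simplex : forall x, simplex (Pf0 x))
    (Pf0_meas : forall y, measurable_fun [set: X] (fun x => Pf0 x 0 y))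
    (Z_law : forall t, (t < T)%N ->
       forall A, measurable A -> distribution P (Z t) A = Q t A)
    (Z_indep : mutually_independent (fun t : 'I_T => Z t))
    (C_inv : confusion Q0 (base_classifier tie Pf0) \in unitmx)
    (diff_C : forall p : 'rV[R]_m.+1, simplex p ->
       differentiable (diag_confusion tie Q0 Pf0) (within orthant (nbhs p)))
    (convex_loss : forall q : 'rV[R]_m.+1, simplex q ->
       convex_function simplex (fun p => loss tie Q0 Pf0 p q : R^o))
    (L_sup : ereal_sup
       [set (norm2 (grad (loss tie Q0 Pf0 ^~ (qhat tie Q0 Pf0 i)) p))%:E
         | p in simplex & i in [set: 'I_m.+1]] = L%:E)
    (eta_def : eta = Num.sqrt (2 / T%:R) * (1 / L)) :
  ('E_P[(fun w => T%:R^-1 * \sum_(t < T)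
          loss tie Q0 Pf0 (ogd tie Q0 Pf0 eta (fun s => (Z s w).1) t)
            (label_marginal (Q t)))%R]
   - ereal_inf [set (T%:R^-1 * \sum_(t < T)
          loss tie Q0 Pf0 p (label_marginal (Q t)))%R%:E | p in simplex]
   <= (Num.sqrt (2 / T%:R) * L)%R%:E)%E.
Proof.
(* Writing [T] as [n.+1] makes [inord] available for indexing rounds. *)
case: T T_gt0 => // n _ in label_shift Z_law Z_indep eta_def *.
pose f0 := base_classifier tie Pf0.
have mf0 A : measurable (f0 @^-1` A) by exact: measurable_base_classifier.
pose C := confusion Q0 f0.
pose q t := label_marginal (Q t).
pose law (t : 'I_n.+1) j := (q t *m C) 0 j.
have lawE (t : 'I_n.+1) j : law t j = fine (Q t ((f0 @^-1` [set j]) `*` setT)).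
  have same := label_shift t (ltn_ord t).
  by rewrite (prediction_law (Q t) Q0 f0 j mf0 Q0_pos same).
(* The iterates used in the sum factor through [J], the random sequence of predicted labels, which
   has finitely many values. *)
pose J w : {ffun 'I_n.+1 -> 'I_m.+1} := [ffun t : 'I_n.+1 => f0 (Z t w).1].
have mA (j : 'I_m.+1) : measurable ((f0 @^-1` [set j]) `*` [set: 'I_m.+1]).
  exact: measurableX.
have JE a : J @^-1` [set a] = \bigcap_(t in [set` [set: 'I_n.+1]%SET])
    Z t @^-1` ((f0 @^-1` [set a t]) `*` setT).
  apply/seteqP; split=> w /=.
    by move=> <- t _; split=> //=; rewrite ffunE.
  move=> h; apply/ffunP => t; rewrite ffunE.
  by have [] := h t; rewrite /= ?inE.
have mJ a : measurable (J @^-1` [set a]).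
  rewrite JE; apply: fin_bigcap_measurable => // t _.
  rewrite -[X in measurable X]setTI; exact: measurable_funPT.
(* Independence, applied to the full set of rounds, turns the law of [J] into a product. *)
have PJ a : fine (P (J @^-1` [set a])) = weight law a.
  rewrite JE Z_indep//.
  have -> : (\prod_(t in [set: 'I_n.+1]%SET)
      P (Z t @^-1` ((f0 @^-1` [set a t]) `*` setT)) = (weight law a)%:E)%E.
    rewrite /weight -prodEFin; apply: eq_big => [t|t _]; first by rewrite inE.
    rewrite lawE fineK ?fin_num_measure//.
    by rewrite -[LHS]/(distribution P (Z t) _) Z_law.
  by [].
have gL p i : simplex p ->
    norm2 (grad (loss tie Q0 Pf0 ^~ (qhat tie Q0 Pf0 i)) p) <= L.
  move=> sp; rewrite -lee_fin -L_sup; apply: ereal_sup_ubound.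
  by exists p => //; exists i.
have EE : ('E_P[(fun w => n.+1%:R^-1 * \sum_(t < n.+1)
     loss tie Q0 Pf0 (ogd tie Q0 Pf0 eta (fun s => (Z s w).1) t) (q t))%R] =
  (n.+1%:R^-1 * \sum_a weight law a * \sum_(t < n.+1)
     loss tie Q0 Pf0
       (ogd_labels tie Q0 Pf0 eta (fun s => a (inord s)) t) (q t))%R%:E)%E.
  pose F (a : {ffun 'I_n.+1 -> 'I_m.+1}) := n.+1%:R^-1 * \sum_(t < n.+1)
     loss tie Q0 Pf0 (ogd_labels tie Q0 Pf0 eta (fun s => a (inord s)) t) (q t).
  transitivity ('E_P[fun w => F (J w)])%E.
    congr expectation; apply/funext => w; congr (_ * _); apply: eq_bigr => t _.
    congr (loss _ _ _ _ _); rewrite ogd_labelsE; apply: eq_ogd_labels => s st.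
    by rewrite ffunE inordK// (ltn_trans st).
  rewrite expectation_fin//; congr EFin; rewrite mulr_sumr.
  by apply: eq_bigr => a _; rewrite PJ mulrC mulrCA.
(* The expectation is finite, so the infimum can be isolated on the right; lying below it means
   lying below the value at every [u]. *)
rewrite EE lee_subel_addr//.
rewrite -leeBlDl//; apply/ereal_infP => _ [u su <-].
rewrite -EFinB lee_fin lerBlDr.
have n0 : 0 < n.+1%:R :> R by rewrite ltr0n.
rewrite -(ler_pM2l n0) mulrDr !mulrA divff ?gt_eqF// !mul1r -mulrA.
apply: weighted_regret => //.
- by move=> t; exact: label_marginal_simplex.
- by move=> t j; rewrite -/(law t j) lawE fine_ge0.
- move=> t; rewrite -(sum_prediction_prob (Q t) f0 mf0).
  by apply: eq_bigr => j _; rewrite -lawE.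
Qed.
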